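(* Let $R$ be an integral domain, $\kappa\in R$, and $\Phi$ the reduction map defined below. For any integers $m,n\ge0$, \[\Phi(x^{2n}y^{2m})=\sum_{i=0}^n\sum_{j=0}^i\binom{2m+2j}{m+j}\binom{m+j}{m}\binom{m}{i-j}(-\kappa)^{i-j}\,b_{n-i}(x^2)+r(x^2)\] for some $r(x^2)\in R[x]$ of degree at most $2m$.
   Context: $b_k(x)=\sum_{i=0}^k\binom{2i}{i}\frac{x^{k-i}}{1-2i}$ for $k\ge0$ (the coefficients are integers). $\Phi:R[x,y,z]\to R[x]$ is the $R$-linear map defined on monomials by recursion on total degree: for $\ell,m,n\ge1$, $\Phi(x^\ell y^mz^n)=\Phi\big(x^{\ell-1}y^{m-1}z^{n-1}(x^2+y^2+z^2-\kappa)\big)$; for $m,n\ge1$, $\Phi(y^mz^n)=\Phi(2xy^{m-1}z^{n-1})$; for $\ell,n\ge1$, $\Phi(x^\ell z^n)=\Phi(2x^{\ell-1}yz^{n-1})$; for $\ell,m\ge1$, $\Phi(x^\ell y^m)=\Phi(2x^{\ell-1}y^{m-1}z)$; and $\Phi(x^\ell)=x^\ell$, $\Phi(y^m)=x^m$, $\Phi(z^n)=x^n$. *)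

(* Defs.v *)
From HB Require Import structures.
From mathcomp Require Import all_boot all_order all_algebra.
From mathcomp Require Import mpoly zify ring.
From mathcomp Require ssrcomplements.

Set Implicit Arguments.
Unset Strict Implicit.
Unset Printing Implicit Defensive.

Import GRing.Theory.
Local Open Scope ring_scope.

(* The division is exact: see [b_coefE] and [b_coef_ratE]. *)
Definition b_coef (i : nat) : int := ('C(2 * i, i)%:Z %/ (1 - 2 * i%:Z))%Z.

Definition b (R : nzRingType) (k : nat) : {poly R} :=
  \sum_(i < k.+1) (b_coef i)%:~R *: 'X^(k - i).

Lemma b_coefE i : (1 - 2 * i%:Z) * b_coef i = 'C(2 * i, i)%:Z.
Proof.
suff dvd : (1 - 2 * i%:Z %| 'C(2 * i, i)%:Z)%Z by rewrite mulrC divzK.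
case: i => [|j]; first by rewrite dvd1z.
have co : coprime (2 * j).+1 j.+1.
  by rewrite coprime_sym; apply/coprimeP => //; exists (2, 1)%N; rewrite /=; lia.
have d : ((2 * j).+1 %| 'C((2 * j).+1, j.+1))%N.
  by rewrite -(Gauss_dvdr _ co) -mul_bin_diag /= dvdn_mulr.
have -> : 1 - 2 * j.+1%:Z = - (2 * j).+1%:Z by lia.
rewrite dvdzE abszN !absz_nat.
have -> : (2 * j.+1 = (2 * j).+2)%N by lia.
rewrite binS; apply: dvdn_add => //.
have <- : 'C((2 * j).+1, j.+1) = 'C((2 * j).+1, j).
  by rewrite -bin_sub; [congr ('C(_, _)) |]; lia.
exact: d.
Qed.

Lemma b_coef_ratE i :
  (b_coef i)%:~R = 'C(2 * i, i)%:R / (1 - 2 * i%:R) :> rat.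
Proof.
have nz : (1 - 2 * i%:Z)%:~R != 0 :> rat by rewrite intr_eq0; lia.
have -> : 1 - 2 * i%:R = (1 - 2 * i%:Z)%:~R :> rat.
  by rewrite rmorphB rmorphM /=.
apply: (canRL (mulfK nz)).
by rewrite -intrM mulrC b_coefE.
Qed.

Section Reduction.
Variables (R : idomainType) (kappa : R).

Definition Vx : {mpoly R[3]} := 'X_(@Ordinal 3 0 isT).
Definition Vy : {mpoly R[3]} := 'X_(@Ordinal 3 1 isT).
Definition Vz : {mpoly R[3]} := 'X_(@Ordinal 3 2 isT).

(* [Phi_rec d l m n] is the image of [x^l y^m z^n]; [d] is fuel, and any
   [d >= l + m + n] gives the same value since each step lowers the total
   degree. *)
Fixpoint Phi_rec (d l m n : nat) : {poly R} :=
  if d is d'.+1 then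
    match l, m, n with
    | l'.+1, m'.+1, n'.+1 =>
        Phi_rec d' l'.+2 m' n' + Phi_rec d' l' m'.+2 n'
        + Phi_rec d' l' m' n'.+2 - kappa *: Phi_rec d' l' m' n'
    | 0, m'.+1, n'.+1 => 2%:R *: Phi_rec d' 1 m' n'
    | l'.+1, 0, n'.+1 => 2%:R *: Phi_rec d' l' 1 n'
    | l'.+1, m'.+1, 0 => 2%:R *: Phi_rec d' l' m' 1
    | _, _, _ => 'X^(l + m + n)
    end
  else 1.

Definition Phi_mon (l m n : nat) : {poly R} := Phi_rec (l + m + n) l m n.

Definition Phi_mnm (e : 'X_{1..3}) : {poly R} :=
  Phi_mon (e (@Ordinal 3 0 isT)) (e (@Ordinal 3 1 isT)) (e (@Ordinal 3 2 isT)).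

Definition Phi (p : {mpoly R[3]}) : {poly R} :=
  \sum_(e <- msupp p) p@_e *: Phi_mnm e.

Lemma PhiwE k (p : {mpoly R[3]}) : (msize p <= k)%N ->
  Phi p = \sum_(e : 'X_{1..3 < k}) p@_e *: Phi_mnm e.
Proof.
move=> le_pk; pose I : subFinType _ := 'X_{1..3 < k}.
rewrite /Phi (ssrcomplements.big_mksub I) //=; first last.
- by move=> x /msize_mdeg_lt /leq_trans; apply.
- by rewrite msupp_uniq.
by rewrite big_rmcond //= => i; move/memN_msupp_eq0 ->; rewrite scale0r.
Qed.

Lemma Phi_is_linear : linear Phi.
Proof.
move=> a p q.
pose k := maxn (msize (a *: p + q)) (maxn (msize p) (msize q)).
rewrite !(@PhiwE k) ?leq_max ?leqnn ?orbT //.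
rewrite scaler_sumr -big_split /=; apply: eq_bigr => e _.
by rewrite mcoeffD mcoeffZ scalerDl scalerA.
Qed.

HB.instance Definition _ :=
  GRing.isLinear.Build R {mpoly R[3]} {poly R} *:%R Phi Phi_is_linear.

Lemma Phi_rec_fuel d l m n : (l + m + n <= d)%N ->
  Phi_rec d l m n = Phi_mon l m n.
Proof.
rewrite /Phi_mon; have [k] := ubnP d.
elim: k d l m n => // k IH d l m n lt_dk le_d.
have H d1 d2 l' m' n' : (d1 < k)%N -> (d2 < k)%N ->
    (l' + m' + n' <= d1)%N -> (l' + m' + n' <= d2)%N ->
    Phi_rec d1 l' m' n' = Phi_rec d2 l' m' n'.
  by move=> ? ? ? ?; rewrite (IH d1) // (IH d2).
move: lt_dk le_d; case: d => [|d] lt_dk le_d.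
  by move: le_d; rewrite leqn0 => /eqP ->.
move: le_d; case E : (l + m + n)%N => [|s] le_d.
  by have [-> -> ->] : [/\ l = 0, m = 0 & n = 0]%N by split; lia.
case: l m n E => [|l] [|m] [|n] E //=.
- by congr (_ *: _); apply: H; lia.
- by congr (_ *: _); apply: H; lia.
- by congr (_ *: _); apply: H; lia.
- by congr (_ + _ + _ - _ *: _); apply: H; lia.
Qed.

Lemma Phi_monomial l m n : Phi (Vx ^+ l * Vy ^+ m * Vz ^+ n) = Phi_mon l m n.
Proof.
rewrite /Vx /Vy /Vz !mpolyXn -!mpolyXD /Phi msuppX big_seq1 mcoeffX eqxx scale1r.
rewrite /Phi_mnm !mnmDE !mulmnE !mnm1E /=.
by congr Phi_mon; rewrite ?muln0 ?mul0n ?muln1 ?mul1n ?addn0 ?add0n.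
Qed.

Lemma Phi_xyz l m n :
  Phi (Vx ^+ l.+1 * Vy ^+ m.+1 * Vz ^+ n.+1) =
  Phi (Vx ^+ l * Vy ^+ m * Vz ^+ n
       * (Vx ^+ 2 + Vy ^+ 2 + Vz ^+ 2 - kappa%:MP)).
Proof.
have -> : Vx ^+ l * Vy ^+ m * Vz ^+ n
       * (Vx ^+ 2 + Vy ^+ 2 + Vz ^+ 2 - kappa%:MP) =
  Vx ^+ l.+2 * Vy ^+ m * Vz ^+ n + Vx ^+ l * Vy ^+ m.+2 * Vz ^+ n
  + Vx ^+ l * Vy ^+ m * Vz ^+ n.+2 - kappa *: (Vx ^+ l * Vy ^+ m * Vz ^+ n).
  by rewrite -mul_mpolyC !exprS expr0; ring.
rewrite linearB !linearD linearZ /= !Phi_monomial.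
rewrite -(@Phi_rec_fuel (l + m + n).+3 l.+1 m.+1 n.+1); last by lia.
by move Ed : (l + m + n).+2 => d; rewrite /= !Phi_rec_fuel //; lia.
Qed.

Lemma Phi_yz m n :
  Phi (Vy ^+ m.+1 * Vz ^+ n.+1) = Phi (2%:R * Vx * Vy ^+ m * Vz ^+ n).
Proof.
have -> : 2%:R * Vx * Vy ^+ m * Vz ^+ n
          = 2%:R *: (Vx ^+ 1 * Vy ^+ m * Vz ^+ n).
  by rewrite scaler_nat -[RHS]mulr_natl expr1 !mulrA.
rewrite -[Vy ^+ _]mul1r -(expr0 Vx) linearZ /= !Phi_monomial.
rewrite -(@Phi_rec_fuel (m + n).+2 0 m.+1 n.+1); last by lia.
by move Ed : (m + n).+1 => d; rewrite /= !Phi_rec_fuel //; lia.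
Qed.

Lemma Phi_xz l n :
  Phi (Vx ^+ l.+1 * Vz ^+ n.+1) = Phi (2%:R * Vx ^+ l * Vy * Vz ^+ n).
Proof.
have -> : 2%:R * Vx ^+ l * Vy * Vz ^+ n
          = 2%:R *: (Vx ^+ l * Vy ^+ 1 * Vz ^+ n).
  by rewrite scaler_nat -[RHS]mulr_natl expr1 !mulrA.
rewrite -[Vx ^+ l.+1]mulr1 -(expr0 Vy) linearZ /= !Phi_monomial.
rewrite -(@Phi_rec_fuel (l + n).+2 l.+1 0 n.+1); last by lia.
by move Ed : (l + n).+1 => d; rewrite /= !Phi_rec_fuel //; lia.
Qed.

Lemma Phi_xy l m :
  Phi (Vx ^+ l.+1 * Vy ^+ m.+1) = Phi (2%:R * Vx ^+ l * Vy ^+ m * Vz).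
Proof.
have -> : 2%:R * Vx ^+ l * Vy ^+ m * Vz
          = 2%:R *: (Vx ^+ l * Vy ^+ m * Vz ^+ 1).
  by rewrite scaler_nat -[RHS]mulr_natl expr1 !mulrA.
rewrite -[Vx ^+ l.+1 * _]mulr1 -(expr0 Vz) linearZ /= !Phi_monomial.
rewrite -(@Phi_rec_fuel (l + m).+2 l.+1 m.+1 0); last by lia.
by move Ed : (l + m).+1 => d; rewrite /= !Phi_rec_fuel //; lia.
Qed.

Lemma Phi_x l : Phi (Vx ^+ l) = 'X^l.
Proof.
rewrite -[Vx ^+ l]mulr1 -(expr0 Vy) -[_ * _]mulr1 -(expr0 Vz) Phi_monomial.
by rewrite /Phi_mon !addn0; case: l => [|l] /=; rewrite ?expr0 ?addn0.
Qed.

Lemma Phi_y m : Phi (Vy ^+ m) = 'X^m.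
Proof.
rewrite -[Vy ^+ m]mul1r -(expr0 Vx) -[_ * _]mulr1 -(expr0 Vz) Phi_monomial.
by rewrite /Phi_mon add0n addn0; case: m => [|m] /=; rewrite ?expr0 ?addn0.
Qed.

Lemma Phi_z n : Phi (Vz ^+ n) = 'X^n.
Proof.
rewrite -[Vz ^+ n]mul1r -[1]mul1r -{1}(expr0 Vx) -(expr0 Vy) Phi_monomial.
by rewrite /Phi_mon !add0n; case: n => [|n] /=; rewrite ?expr0.
Qed.

End Reduction.

Arguments Vx {R}.
Arguments Vy {R}.
Arguments Vz {R}.

(* Main.v *)
(* For fixed [x = s + 1/s], the conic [y^2 + z^2 - x y z = kappa - x^2] is
   parametrized by [y = A (w + 1/w)], [z = A (s w + 1/(s w))] with
   [A^2 = (x^2 - kappa) / (x^2 - 4)].  Averaging a polynomial over the conic, i.e.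
   taking the constant term in [w], satisfies every rule defining [Phi] except the
   ones for [y^m z^n], [y^m] and [z^n], where both sides have low degree.  Hence
   [Phi (x^(2n) y^(2m))] agrees with ['C(2m, m) x^(2n) A^(2m)] up to terms of degree
   at most [2m] in [x].  On the other side, the [b_k] have generating function
   [sqrt (1 - 4 t) / (1 - x t)], and the coefficients of the double sum have
   generating function ['C(2m, m) (1 - kappa t)^m (1 - 4 t)^(- m - 1/2)], so the
   double sum is the polynomial part of the same function.  Denominators are cleared
   by the monic polynomial [(x^2 - 4)^m]. *)
Require Import Defs.
From mathcomp Require Import all_boot all_order all_algebra.
From mathcomp Require Import mpoly zify ring.

Set Implicit Arguments.
Unset Strict Implicit.
Unset Printing Implicit Defensive.

Import GRing.Theory Num.Theory.
Local Open Scope ring_scope.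

(** * Degree bounds for sums, products and powers *)

Lemma size_addS (R : nzSemiRingType) (p q : {poly R}) a :
  (size p <= a)%N -> (size q <= a)%N -> (size (p + q)%R <= a)%N.
Proof. by move=> hp hq; rewrite (leq_trans (size_polyD _ _)) // geq_max hp. Qed.

Lemma size_subS (R : nzRingType) (p q : {poly R}) a :
  (size p <= a)%N -> (size q <= a)%N -> (size (p - q)%R <= a)%N.
Proof. by move=> hp hq; rewrite size_addS ?size_polyN. Qed.

Lemma size_mulS (R : nzSemiRingType) (p q : {poly R}) a b :
  (size p <= a.+1)%N -> (size q <= b.+1)%N -> (size (p * q)%R <= (a + b).+1)%N.
Proof. by move=> hp hq; apply: leq_trans (size_polyMleq _ _) _; lia. Qed.

Lemma size_expS (R : nzSemiRingType) (p : {poly R}) a k :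
  (size p <= a.+1)%N -> (size (p ^+ k)%R <= (a * k).+1)%N.
Proof.
by move=> hp; apply: leq_trans (size_poly_exp_leq _ _) _; rewrite ltnS leq_mul2r; lia.
Qed.

(** * Central binomial coefficients *)

Lemma double_bin_odd k : (2 * 'C((2 * k).+1, k.+1) = 'C(2 * k.+1, k.+1))%N.
Proof.
have -> : (2 * k.+1 = (2 * k).+2)%N by lia.
have e : 'C((2 * k).+1, k.+1) = 'C((2 * k).+1, k).
  by rewrite -bin_sub; [congr ('C(_, _)) |]; lia.
by rewrite (binS (2 * k).+1) -e; lia.
Qed.

Lemma mul_central_binS k :
  (k.+1 * 'C(2 * k.+1, k.+1) = 2 * ((2 * k).+1 * 'C(2 * k, k)))%N.
Proof. by rewrite -double_bin_odd (mul_bin_diag (2 * k).+1 k); lia. Qed.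

(** * Constant terms of products of powers *)

Definition cbin m : nat := if odd m then 0 else 'C(m, m./2).

(** The coefficient of [w] in [(w + 1/w)^m], whose constant term is [cbin m]. *)
Definition cbin_odd m : nat := if odd m then 'C(m, uphalf m) else 0.

Lemma cbin_even k : cbin (2 * k) = 'C(2 * k, k).
Proof. by rewrite /cbin mul2n odd_double doubleK. Qed.

Lemma double_cbin_odd m : (2 * cbin_odd m = cbin m.+1)%N.
Proof.
rewrite /cbin /cbin_odd /=; case: ifP => //= hm.
have [k ->] : exists k, m = (2 * k).+1 by exists m./2; lia.
have -> : uphalf (2 * k).+1 = k.+1 by lia.
by rewrite double_bin_odd; congr ('C(_, _)); lia.
Qed.

Lemma cbinSS m : (m.+2 * cbin m.+2 = 4 * (m.+1 * cbin m))%N.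
Proof.
rewrite /cbin /= negbK; case: ifP => hm; first by rewrite !muln0.
have [k ->] : exists k, m = (2 * k)%N by exists m./2; lia.
have -> : (2 * k)./2 = k by lia.
have := mul_central_binS k.
have -> : (2 * k.+1 = (2 * k).+2)%N by lia.
by lia.
Qed.

(* The constant term in [w] of [(w + 1/w)^m (s w + 1/(s w))^n], as a polynomial in
   [x = s + 1/s].  The recursion comes from [x y z = x^2 + y^2 + z^2 - 4] for
   [y = w + 1/w] and [z = s w + 1/(s w)]. *)
Fixpoint ct (m n : nat) : {poly int} :=
  match n with
  | 0 => (cbin m)%:R
  | n1.+1 =>
    match n1 with
    | 0 => (cbin_odd m)%:R * 'X
    | n2.+1 => 'X * ct m.+1 n1 - ('X^2 - 4) * ct m n2 - ct m.+2 n2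
    end
  end.

Lemma ct0 m : ct m 0 = (cbin m)%:R.
Proof. by []. Qed.

Lemma ct1 m : ct m 1 = (cbin_odd m)%:R * 'X.
Proof. by []. Qed.

Lemma ctSS m n :
  ct m n.+2 = 'X * ct m.+1 n.+1 - ('X^2 - 4) * ct m n - ct m.+2 n.
Proof. by []. Qed.

Arguments ct : simpl never.

(* The derivation [(s - 1/s) w d/dw] maps [y] to [2 z - x y] and [z] to
   [x z - 2 y], and constant terms of derivatives vanish. *)
Lemma ct_derivation m n :
  2 * m%:R * ct m.-1 n.+1 + (n%:R - m%:R) * 'X * ct m n
    - 2 * n%:R * ct m.+1 n.-1 = 0.
Proof.
have [k] := ubnP n; elim: k m n => // k IH m [|[|n]] lt_nk.
- case: m => [|m]; first by rewrite !(mulr0n, subr0, mul0r, mulr0, addr0).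
  by rewrite ct0 ct1 -double_cbin_odd natrM; ring.
- have h : 2 * (cbin_odd m)%:R = (cbin m.+1)%:R :> {poly int}.
    by rewrite -double_cbin_odd natrM.
  case: m h => [|m] h.
    by rewrite ct0 ct1 -h (_ : cbin_odd 0 = 0%N) // !(mulr0n, mul0r, mulr0, addr0, subr0).
  rewrite [_.-1]/= ctSS !ct0 ct1 -h.
  have e : m.+2%:R * (cbin m.+2)%:R = 4 * (m.+1%:R * (cbin m)%:R) :> {poly int}.
    by rewrite -!natrM cbinSS natrM.
  have -> : 2 * (m.+1)%:R *
     ('X * ((cbin_odd m.+1)%:R * 'X) - ('X^2 - 4) * (cbin m)%:R
       - 2 * (cbin_odd m.+1)%:R) +
     (1%:R - (m.+1)%:R) * 'X * ((cbin_odd m.+1)%:R * 'X) -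
     2 * 1%:R * (2 * (cbin_odd m.+1)%:R)
   = ('X^2 - 4) * (m.+2%:R * (cbin_odd m.+1)%:R - 2 * (m.+1%:R * (cbin m)%:R))
      :> {poly int} by ring.
  have -> : m.+2%:R * (cbin_odd m.+1)%:R = 2 * (m.+1%:R * (cbin m)%:R)
      :> {poly int}.
    apply: (@mulfI _ 2); first by rewrite -(polyC_natr _ 2) polyC_eq0.
    by rewrite [LHS]mulrCA h e; ring.
  by rewrite subrr mulr0.
- have h1 := IH m.+1 n.+1 ltac:(lia).
  have h2 := IH m n ltac:(lia).
  have h3 := IH m.+2 n ltac:(lia).
  rewrite /= in h1 h2 h3 *.
  (* The factors [m] and [n] make the recursion for [ct] usable at [m.-1] and [n.-1], including at
     zero. *)
  have r1 : m%:R * (ct m.-1 n.+3 - ('X * ct m n.+2 - ('X^2 - 4) * ct m.-1 n.+1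
      - ct m.+1 n.+1)) = 0.
    by case: (m) => [|m']; rewrite ?mul0r // [ct _ n.+3]ctSS subrr mulr0.
  have r2 : n%:R * (ct m.+1 n.+1 - ('X * ct m.+2 n - ('X^2 - 4) * ct m.+1 n.-1
      - ct m.+3 n.-1)) = 0.
    by case: (n) => [|n']; rewrite ?mul0r // ctSS subrr mulr0.
  (* The identity at [(m, n.+2)] is the combination of those at [(m.+1, n.+1)], [(m, n)] and
     [(m.+2, n)] that defines [ct m n.+2], up to the corrections [r1] and [r2]. *)
  transitivity ('X * (2 * (m.+1)%:R * ct m n.+2
      + (n.+1%:R - (m.+1)%:R) * 'X * ct m.+1 n.+1 - 2 * n.+1%:R * ct m.+2 n)
    - ('X^2 - 4) * (2 * m%:R * ct m.-1 n.+1 + (n%:R - m%:R) * 'X * ct m n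
    - 2 * n%:R * ct m.+1 n.-1)
    - (2 * (m.+2)%:R * ct m.+1 n.+1 + (n%:R - (m.+2)%:R) * 'X * ct m.+2 n
    - 2 * n%:R * ct m.+3 n.-1)).
    apply/eqP; rewrite -subr_eq0; apply/eqP.
    have := congr2 (fun a b => 2 * a - 2 * b) r1 r2.
    by rewrite mulr0 subrr => <-; rewrite [ct m n.+2]ctSS; ring.
  by rewrite h1 h2 h3 !mulr0 !subr0.
Qed.

(** The derivation identity at [m = 0], divided by [n.+1]. It is what the rule for [x^l z^n] becomes
    for constant terms; [ctm1] plays this role for [x^l y^m]. *)
Lemma ct1n n : 2 * ct 1 n = 'X * ct 0 n.+1.
Proof.
have := ct_derivation 0 n.+1; rewrite /= mulr0n mulr0 mul0r add0r subr0 => /eqP.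
rewrite subr_eq0 => /eqP e; apply: (@mulfI _ n.+1%:R).
  by rewrite -polyC_natr polyC_eq0 pnatr_eq0.
by rewrite [RHS]mulrA e; ring.
Qed.

Lemma ctm1 m : 2 * ct m 1 = 'X * ct m.+1 0.
Proof. by rewrite ct0 ct1 -double_cbin_odd natrM; ring. Qed.

Lemma size_ct m n : (size (ct m n) <= n.+1)%N.
Proof.
have [k] := ubnP n; elim: k m n => // k IH m [|[|n]] lt_nk.
- by rewrite ct0 -polyC_natr size_polyC; case: eqP.
- rewrite ct1 -polyC_natr mul_polyC (leq_trans (size_scale_leq _ _)) //.
  by rewrite size_polyX.
have h0 : (size (ct m n) <= n.+1)%N by apply: IH; lia.
have h1 : (size (ct m.+1 n.+1) <= n.+2)%N by apply: IH; lia.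
have h2 : (size (ct m.+2 n) <= n.+1)%N by apply: IH; lia.
have hX : (size ('X : {poly int}) <= 2)%N by rewrite size_polyX.
have hA : (size ('X^2 - 4 : {poly int})%R <= 3)%N.
  by rewrite -(polyC_natr _ 4) size_XnsubC.
rewrite ctSS; apply: size_subS; last by rewrite (leq_trans h2) //; lia.
apply: size_subS; [exact: size_mulS hX h1 | exact: size_mulS hA h0].
Qed.

(** * The reduction map on monomials *)

Lemma Phi_monE (R : idomainType) (kappa : R) l m n :
  Phi_mon kappa l m n =
  match l, m, n with
  | l'.+1, m'.+1, n'.+1 =>
      Phi_mon kappa l'.+2 m' n' + Phi_mon kappa l' m'.+2 n'
      + Phi_mon kappa l' m' n'.+2 - kappa *: Phi_mon kappa l' m' n'
  | 0, m'.+1, n'.+1 => 2%:R *: Phi_mon kappa 1 m' n'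
  | l'.+1, 0, n'.+1 => 2%:R *: Phi_mon kappa l' 1 n'
  | l'.+1, m'.+1, 0 => 2%:R *: Phi_mon kappa l' m' 1
  | _, _, _ => 'X^(l + m + n)
  end.
Proof.
(* One spare unit of fuel unfolds exactly one step, even for the monomial 1. *)
rewrite -(@Phi_rec_fuel _ kappa (l + m + n).+1) //.
move Ed : (l + m + n)%N => d.
by case: l m n Ed => [|l] [|m] [|n] Ed /=; rewrite ?Ed ?Phi_rec_fuel //; lia.
Qed.

Lemma size_Phi_mon (R : idomainType) (kappa : R) l m n :
  (size (Phi_mon kappa l m n) <= (l + m + n).+1)%N.
Proof.
have [k] := ubnP (l + m + n)%N; elim: k l m n => // k IH l m n lt_k.
have hS (a : R) l' m' n' : (l' + m' + n' < l + m + n)%N ->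
    (size (a *: Phi_mon kappa l' m' n') <= (l + m + n).+1)%N.
  move=> lt'; apply: leq_trans (size_scale_leq _ _) _.
  by apply: leq_trans (IH _ _ _ _) _; lia.
rewrite Phi_monE; case: l m n lt_k hS => [|l] [|m] [|n] lt_k hS;
  rewrite ?size_polyXn //; try by apply: hS; lia.
rewrite -[Phi_mon _ l.+2 m n]scale1r -[Phi_mon _ l m.+2 n]scale1r.
rewrite -[Phi_mon _ l m n.+2]scale1r.
apply: size_subS; last by apply: hS; lia.
apply: size_addS; last by apply: hS; lia.
by apply: size_addS; apply: hS; lia.
Qed.

(** Each rule preserves equality of the three parities. At a pure power two exponents are zero, so
    the third is even. *)
Lemma Phi_mon_even (R : idomainType) (kappa : R) l m n :
  odd l = odd m -> odd m = odd n ->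
  exists q : {poly R}, Phi_mon kappa l m n = q \Po 'X^2.
Proof.
have [k] := ubnP (l + m + n)%N; elim: k l m n => // k IH l m n lt_k.
have hXn d : ~~ odd d -> exists q : {poly R}, 'X^d = q \Po 'X^2.
  move=> hd; exists 'X^(d./2); rewrite comp_Xn_poly -exprM.
  by congr (_ ^+ _); lia.
rewrite Phi_monE; case: l m n lt_k => [|l] [|m] [|n] lt_k; move=> o1 o2;
  try by apply: hXn; move: o1 o2; rewrite /=; lia.
- have [||| q ->] := IH 1%N m n; try by move: o1 o2; rewrite /=; lia.
  by exists (2%:R *: q); rewrite comp_polyZ.
- have [||| q ->] := IH l 1%N n; try by move: o1 o2; rewrite /=; lia.
  by exists (2%:R *: q); rewrite comp_polyZ.
- have [||| q ->] := IH l m 1%N; try by move: o1 o2; rewrite /=; lia.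
  by exists (2%:R *: q); rewrite comp_polyZ.
have [||| q1 ->] := IH l.+2 m n; try by move: o1 o2; rewrite /=; lia.
have [||| q2 ->] := IH l m.+2 n; try by move: o1 o2; rewrite /=; lia.
have [||| q3 ->] := IH l m n.+2; try by move: o1 o2; rewrite /=; lia.
have [||| q4 ->] := IH l m n; try by move: o1 o2; rewrite /=; lia.
by exists (q1 + q2 + q3 - kappa *: q4); rewrite comp_polyB !comp_polyD comp_polyZ.
Qed.

(** * Comparison of [Phi] with the average over the conic *)

(** The identities for [ct] are proved over the integers because they cancel 2 and [n.+1], which may
    vanish in [R]. *)
Definition ctR (R : nzRingType) m n : {poly R} := map_poly intr (ct m n).

Section CtR.
Variable R : comNzRingType.

Lemma ctR0 m : ctR R m 0 = (cbin m)%:R.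
Proof. by rewrite /ctR ct0 rmorph_nat. Qed.

Lemma ctR_SS m n :
  'X * ctR R m.+1 n.+1 =
  ('X^2 - 4) * ctR R m n + ctR R m.+2 n + ctR R m n.+2.
Proof.
rewrite /ctR ctSS !(rmorphB, rmorphM, rmorph_nat) /= map_polyX.
by ring.
Qed.

Lemma ctR_m1 m : 2 * ctR R m 1 = 'X * ctR R m.+1 0.
Proof.
by rewrite /ctR -[X in X * _](rmorph_nat (map_poly intr)) -rmorphM ctm1 rmorphM /=
  map_polyX.
Qed.

Lemma ctR_1n n : 2 * ctR R 1 n = 'X * ctR R 0 n.+1.
Proof.
by rewrite /ctR -[X in X * _](rmorph_nat (map_poly intr)) -rmorphM ct1n rmorphM /=
  map_polyX.
Qed.

Lemma size_ctR m n : (size (ctR R m n) <= n.+1)%N.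
Proof. exact: leq_trans (size_poly _ _) (size_ct m n). Qed.

End CtR.

(* The two terms are the map [Phi] and the average over the conic, multiplied by
   [(X^2 - 4)^((m + n) / 2)]; for [m + n] odd the average is [0]. *)
Definition defect (R : idomainType) (kappa : R) l m n : {poly R} :=
  ('X^2 - 4) ^+ (m + n)./2 * Phi_mon kappa l m n
  - 'X^l * ('X^2 - kappa%:P) ^+ (m + n)./2 * ctR R m n.

(** The bound does not depend on [l]: for [l > 0] the two terms obey the same rules, so induction
    leads to [l = 0], where each term is small enough by itself, or to [m = n = 0], where they
    cancel. *)
Lemma size_defect (R : idomainType) (kappa : R) l m n :
  (size (defect kappa l m n) <= (2 * (m + n)./2 + (m + n)).+1)%N.
Proof.
have hA : (size ('X^2 - 4 : {poly R})%R <= 3)%N.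
  by rewrite -(polyC_natr _ 4) size_XnsubC.
have hB : (size ('X^2 - kappa%:P : {poly R})%R <= 3)%N by rewrite size_XnsubC.
have [k] := ubnP (l + m + n)%N; elim: k l m n => // k IH l m n lt_k.
have base l' : l' = 0%N -> (size (defect kappa l' m n) <= (2 * (m + n)./2 + (m + n)).+1)%N.
  move=> ->; apply: size_subS.
    by apply: size_mulS; [apply: size_expS | apply: size_Phi_mon].
  rewrite mul1r.
  apply: leq_trans (size_mulS (size_expS (m + n)./2 hB) (size_ctR R m n)) _.
  by lia.
case: l m n lt_k base => [|l] [|m] [|n] lt_k base; try exact: base.
- rewrite /defect Phi_monE ctR0 !addn0 !expr0 !mul1r mulr1 /cbin /=.
  by rewrite bin0 mulr1 subrr size_poly0.
- have -> : defect kappa l.+1 0 n.+1 = 2%:R *: defect kappa l 1 n.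
    rewrite /defect Phi_monE add0n add1n -!mul_polyC !(polyC_natr _ 2).
    have := ctR_1n R n; move: (ctR R 1 n) (ctR R 0 n.+1) (n.+1)./2 => c c' d e.
    by rewrite [X in _ - X = _](_ : _ = 'X^l * ('X^2 - kappa%:P) ^+ d
      * ('X * c')); [rewrite -e|rewrite (exprS 'X l)]; ring.
  rewrite (leq_trans (size_scale_leq _ _)) // (leq_trans (IH _ _ _ _)) //.
  by lia.
- have -> : defect kappa l.+1 m.+1 0 = 2%:R *: defect kappa l m 1.
    rewrite /defect Phi_monE addn0 addn1 -!mul_polyC !(polyC_natr _ 2).
    have := ctR_m1 R m; move: (ctR R m 1) (ctR R m.+1 0) (m.+1)./2 => c c' d e.
    by rewrite [X in _ - X = _](_ : _ = 'X^l * ('X^2 - kappa%:P) ^+ d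
      * ('X * c')); [rewrite -e|rewrite (exprS 'X l)]; ring.
  rewrite (leq_trans (size_scale_leq _ _)) // (leq_trans (IH _ _ _ _)) //; lia.
(* In the average, the contributions of [x^2] and [- kappa] merge into one more factor
   ['X^2 - kappa%:P], as the exponent [(m + n)./2.+1] requires. *)
have -> : defect kappa l.+1 m.+1 n.+1 =
    ('X^2 - 4) * defect kappa l.+2 m n + defect kappa l m.+2 n
    + defect kappa l m n.+2 - kappa *: (('X^2 - 4) * defect kappa l m n).
  rewrite /defect Phi_monE addSn !addnS addSn addSn /= -!mul_polyC.
  rewrite [X in _ - X = _](_ : _ = 'X^l *
    ('X^2 - kappa%:P) ^+ (m + n)./2.+1 * ('X * ctR R m.+1 n.+1)); last first.
    by rewrite (exprS 'X l); ring.
  rewrite ctR_SS (exprS 'X l.+1) (exprS 'X l) !(exprS (_ - _)).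
  move: ('X^l) (('X^2 - kappa%:P) ^+ _) (('X^2 - 4) ^+ _) => Xl B A.
  by ring.
have hd l' m' n' d : (l' + m' + n' < k)%N -> (2 * (m' + n')./2 + (m' + n') <= d)%N ->
    (size (defect kappa l' m' n') <= d.+1)%N.
  by move=> lt' le_d; apply: leq_trans (IH _ _ _ lt') _.
have bd : (2 * (m.+1 + n.+1)./2 + (m.+1 + n.+1)
  = 2 + (2 * (m + n)./2 + (m + n) + 2))%N by lia.
apply: size_subS; last first.
  rewrite (leq_trans (size_scale_leq _ _)) // bd.
  by apply: size_mulS hA _; apply: hd; lia.
apply: size_addS; last by apply: hd; lia.
apply: size_addS; last by apply: hd; lia.
by rewrite bd; apply: size_mulS hA _; apply: hd; lia.
Qed.

(** * The numbers [b_coef i] and the polynomials [b R k] *)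

#[local] Arguments b_coef : simpl never.

Lemma b_coef0 : b_coef 0 = 1.
Proof. by []. Qed.

(** The coefficient form of [(1 - 4 t) f' = - 2 f] for [f = sqrt (1 - 4 t)]. *)
Lemma b_coefS i : i.+1%:R * b_coef i.+1 = (4 * i%:R - 2) * b_coef i.
Proof.
have e1 := b_coefE i.+1; have e0 := b_coefE i.
have e := congr1 (fun n : nat => n%:Z) (mul_central_binS i).
rewrite !PoszM -e1 -e0 in e.
apply: (@mulfI _ ((2 * i).+1%:Z)) => //.
by move: e; rewrite -!natz => e; lia.
Qed.

Lemma b0 (R : nzRingType) : b R 0 = 1.
Proof. by rewrite /b big_ord1 b_coef0 scale1r. Qed.

Lemma bS (R : comNzRingType) k : b R k.+1 = 'X * b R k + (b_coef k.+1)%:~R%:P.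
Proof.
rewrite /b big_ord_recr /= subnn expr0 alg_polyC; congr (_ + _).
rewrite mulr_sumr; apply: eq_bigr => i _.
by rewrite -scalerAr -exprS subSn // -ltnS.
Qed.

Lemma map_b (R : nzRingType) k : map_poly intr (b int k) = b R k.
Proof.
rewrite /b rmorph_sum; apply: eq_bigr => i _.
by rewrite /= map_polyZ /= map_polyXn intz.
Qed.

(** * Cauchy products and sums weighted by the [b_k] *)

Definition conv (g h : nat -> int) k : int :=
  \sum_(0 <= j < k.+1) g j * h (k - j)%N.

(** This is [(1 - 4 t)^(-1/2) (1 - 4 t)^(1/2) = 1]: the product [p] satisfies [(1 - 4 t) p' = 0], so
    only its constant term survives. *)
Lemma conv_central_b_coef k :
  conv (fun j => 'C(2 * j, j)%:R) b_coef k = (k == 0%N)%:R.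
Proof.
set a := fun j => _.
have aS j : j.+1%:R * a j.+1 = (4 * j%:R + 2) * a j.
  rewrite /a -natrM mul_central_binS !natrM.
  by rewrite mulrA; congr (_ * _); lia.
have cS i : i.+1%:R * conv a b_coef i.+1 = 4 * i%:R * conv a b_coef i.
  (* The product rule: [i.+1] splits as [j + (i.+1 - j)]. *)
  have -> : i.+1%:R * conv a b_coef i.+1 =
    \sum_(0 <= j < i.+2) j%:R * a j * b_coef (i.+1 - j)
    + \sum_(0 <= j < i.+2) a j * ((i.+1 - j)%:R * b_coef (i.+1 - j)).
    rewrite mulr_sumr -big_split; apply: eq_big_nat => j hj /=.
    by rewrite natrB; [ring | lia].
  rewrite big_nat_recl // [X in _ + X]big_nat_recr //= subnn !mul0r mulr0 addr0.
  rewrite add0r -big_split mulr_sumr; apply: eq_big_nat => j hj /=.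
  rewrite aS subSS subSn; last by lia.
  by rewrite b_coefS natrB; [ring | lia].
case: k => [|k]; first by rewrite /conv big_nat1 /a b_coef0.
suff: k.+1%:R * conv a b_coef k.+1 = 0.
  by move/eqP; rewrite mulf_eq0 pnatr_eq0 => /eqP.
elim: k => [|k IH]; first by rewrite cS mulr0 mul0r.
move/eqP: IH; rewrite mulf_eq0 pnatr_eq0 => /eqP e0.
by rewrite cS e0 mulr0.
Qed.

(** For [g(t)] with coefficients [g j], the coefficient of [t^N] in
    [g(t) sqrt (1 - 4 t) / (1 - X t)]. *)
Definition bsum (g : nat -> int) N : {poly int} :=
  \sum_(0 <= j < N.+1) g j *: b int (N - j).

Lemma bsumS g N : bsum g N.+1 = 'X * bsum g N + (conv g b_coef N.+1)%:P.
Proof.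
rewrite /bsum /conv big_nat_recr //= [X in X%:P]big_nat_recr //= !subnn b0 b_coef0.
rewrite mulr1 polyCD addrA alg_polyC rmorph_sum mulr_sumr -big_split /=.
congr (_ + _); apply: eq_big_nat => j hj.
by rewrite subSn 1?bS; [rewrite scalerDr scalerAr -!mul_polyC -polyCM intz | lia].
Qed.

(** Here [g'] is the coefficient sequence of [(1 - 4 t) g(t)]; this trades a factor ['X - 4] for a
    shift of [N] and a constant. *)
Lemma bsum_diff g N (g' := fun j => if j is i.+1 then g j - 4 * g i else g 0%N) :
  bsum g' N.+1 = ('X - 4) * bsum g N + (conv g b_coef N.+1)%:P.
Proof.
rewrite mulrBl addrAC -bsumS /bsum big_nat_recl // [in RHS]big_nat_recl //=.
rewrite -addrA mulr_sumr -sumrB; congr (_ + _); apply: eq_big_nat => j hj.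
by rewrite subSS scalerBl -(polyC_natr _ 4) -!mul_polyC polyCM mulrA.
Qed.

Lemma bsum_central N : bsum (fun j => 'C(2 * j, j)%:R) N = 'X^N.
Proof.
elim: N => [|N IH]; first by rewrite /bsum big_nat1 b0 bin0 scale1r.
by rewrite bsumS conv_central_b_coef IH addr0 exprS.
Qed.

(** * The coefficients independent of [kappa] *)

Definition coefG m j : int := ('C(2 * m + 2 * j, m + j) * 'C(m + j, m))%:R.

(* [coefG m] is the coefficient sequence of ['C(2m, m) (1 - 4 t)^(- m - 1/2)]. *)
Lemma coefG_diff m j :
  m.+1%:R * (if j is i.+1 then coefG m.+1 j - 4 * coefG m.+1 i
             else coefG m.+1 0) = (2 * (2 * m).+1)%:R * coefG m j.
Proof.
rewrite /coefG; case: j => [|j].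
  rewrite !addn0 !binn !muln1 -!natrM mul_central_binS.
  by congr (_%:R); lia.
have [N eN] : exists N, N = (m + j).+1 by exists (m + j).+1.
have -> : (2 * m.+1 + 2 * j.+1 = 2 * N.+1)%N by lia.
have -> : (2 * m.+1 + 2 * j = 2 * N)%N by lia.
have -> : (2 * m + 2 * j.+1 = 2 * N)%N by lia.
have -> : (m.+1 + j.+1 = N.+1)%N by lia.
have -> : (m.+1 + j = N)%N by lia.
have -> : (m + j.+1 = N)%N by lia.
have e1 := mul_bin_diag N.+1 m.
have e2 := mul_bin_left N m.
have e3 := mul_central_binS N.
rewrite /= in e1.
rewrite mulrBr mulrCA -!natrM.
have -> : (m.+1 * ('C(2 * N.+1, N.+1) * 'C(N.+1, m.+1)) =
  'C(2 * N, N) * 'C(N, m) * (2 * (2 * N).+1))%N.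
  by rewrite mulnCA -e1 mulnA [X in (X * _)%N = _]mulnC e3; lia.
have -> : (m.+1 * ('C(2 * N, N) * 'C(N, m.+1)) =
  'C(2 * N, N) * 'C(N, m) * (N - m))%N.
  by rewrite mulnCA e2; lia.
set c := ('C(2 * N, N) * 'C(N, m))%N.
(* What remains is [2 (2 N + 1) - 4 (N - m) = 2 (2 m + 1)]. *)
by rewrite !natrM natrB; [ring | lia].
Qed.

(** Times [sqrt (1 - 4 t)], the series of [coefG m] becomes ['C(2m, m) (1 - 4 t)^(-m)], so [bsum] is
    the polynomial part of ['C(2m, m) X^(N + m) / (X - 4)^m]. Clearing the denominator leaves an
    error of degree below [m]. *)
Lemma size_bsum_coefG m N :
  (size (('X - 4) ^+ m * bsum (coefG m) N - 'C(2 * m, m)%:R * 'X^(N + m))%R <= m)%N.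
Proof.
elim: m N => [|m IH] N.
  rewrite mul1r addn0 (_ : bsum _ _ = 'X^N) ?mul1r ?subrr ?size_poly0 //.
  rewrite -bsum_central; apply: eq_big_nat => j _.
  by rewrite /coefG muln0 !add0n bin0 muln1.
have h0 : (m.+1%:R : int) != 0 by rewrite pnatr_eq0.
rewrite -(size_scale _ h0).
set c := (conv (coefG m.+1) b_coef N.+1).
(* One factor ['X - 4] passes from [m.+1] to [m]; the constant [c] later contributes degree at most
   [m]. *)
have e : m.+1%:R *: (('X - 4) * bsum (coefG m.+1) N)
   = (2 * (2 * m).+1)%:R *: bsum (coefG m) N.+1 - m.+1%:R *: c%:P.
  apply/eqP; rewrite -subr_eq opprK -scalerDr -bsum_diff; apply/eqP.
  rewrite /bsum !scaler_sumr; apply: eq_big_nat => j _.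
  by rewrite !scalerA coefG_diff.
rewrite scalerBr exprSr -mulrA scalerAr e.
have -> : m.+1%:R *: ('C(2 * m.+1, m.+1)%:R * 'X^(N + m.+1) : {poly int})
    = (2 * (2 * m).+1)%:R *: ('C(2 * m, m)%:R * 'X^(N.+1 + m)).
  rewrite -!mul_polyC !polyC_natr !mulrA -!natrM mul_central_binS.
  by rewrite addnS addSn; congr (_%:R * _); lia.
rewrite mulrBr -scalerAr addrAC -scalerBr.
apply: size_subS.
  by rewrite (leq_trans (size_scale_leq _ _)) // (leq_trans (IH _)).
rewrite -scalerAr (leq_trans (size_scale_leq _ _)) //.
have h1 : (size ('X - 4 : {poly int})%R <= 2)%N.
  by rewrite -(polyC_natr _ 4) size_XsubC.
have h2 : (size (c%:P) <= 1)%N by rewrite size_polyC leq_b1.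
by have := size_mulS (size_expS m h1) h2; rewrite mul1n addn0.
Qed.

(** * The double sum as a polynomial part *)

Lemma sum_antidiagonal (V : nmodType) n (F : nat -> nat -> V) :
  \sum_(0 <= i < n.+1) \sum_(0 <= j < i.+1) F j (i - j)%N =
  \sum_(0 <= h < n.+1) \sum_(0 <= j < (n - h).+1) F j h.
Proof.
elim: n => [|n IH]; first by rewrite !big_nat1.
rewrite big_nat_recr //= IH [in RHS]big_nat_recr //= subnn big_nat1.
have -> : \sum_(0 <= h < n.+1) \sum_(0 <= j < (n.+1 - h).+1) F j h =
  \sum_(0 <= h < n.+1) (\sum_(0 <= j < (n - h).+1) F j h + F (n.+1 - h)%N h).
  apply: eq_big_nat => h hh; rewrite subSn; last by lia.
  by rewrite big_nat_recr.
rewrite big_split -addrA; congr (_ + _).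
rewrite big_nat_rev big_nat_recr //= add0n subSS subnn; congr (_ + _).
by apply: eq_big_nat => h hh; congr (F _ _); lia.
Qed.

(** The double sum before ['X^2] is substituted for ['X]. *)
Definition main_sum (R : comNzRingType) (kappa : R) m n : {poly R} :=
  \sum_(0 <= i < n.+1) \sum_(0 <= j < i.+1)
    (('C(2 * m + 2 * j, m + j) * 'C(m + j, m) * 'C(m, i - j))%:R
      * (- kappa) ^+ (i - j)) *: b R (n - i).

(** Grouping by [h = i - j] separates the factor [(1 - kappa t)^m]. *)
Lemma main_sumE (R : comNzRingType) (kappa : R) m n :
  main_sum kappa m n = \sum_(0 <= h < n.+1)
    ('C(m, h)%:R * (- kappa) ^+ h) *: map_poly intr (bsum (coefG m) (n - h)).
Proof.
pose F j h := (('C(2 * m + 2 * j, m + j) * 'C(m + j, m) * 'C(m, h))%:R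
      * (- kappa) ^+ h) *: b R (n - (j + h)).
transitivity (\sum_(0 <= i < n.+1) \sum_(0 <= j < i.+1) F j (i - j)%N).
  apply: eq_big_nat => i hi; apply: eq_big_nat => j hj; rewrite /F.
  by congr (_ *: b R _); lia.
rewrite sum_antidiagonal; apply: eq_big_nat => h hh.
rewrite /bsum rmorph_sum scaler_sumr; apply: eq_big_nat => j hj /=.
rewrite map_polyZ map_b scalerA /F /coefG rmorph_nat; congr (_ *: b R _).
  by rewrite (natrM _ _ 'C(m, h)); ring.
by lia.
Qed.

Lemma size_main_sum (R : comNzRingType) (kappa : R) m n :
  (size (('X - 4) ^+ m * main_sum kappa m n
     - 'C(2 * m, m)%:R * 'X^n * ('X - kappa%:P) ^+ m)%R <= m)%N.
Proof.
pose c h : R := 'C(m, h)%:R * (- kappa) ^+ h.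
pose t h : {poly R} := c h *: ('C(2 * m, m)%:R * 'X^(n + m - h)).
(* The binomial expansion, padded with zero terms for [h > m] so that it can be cut at [n] whether
   or not [n < m]. *)
have -> : 'C(2 * m, m)%:R * 'X^n * ('X - kappa%:P) ^+ m =
    \sum_(0 <= h < n.+1) t h + \sum_(n.+1 <= h < n.+1 + m) t h.
  rewrite -big_cat_nat //=; last by lia.
  rewrite (big_cat_nat (n := m.+1)) //=; last by lia.
  rewrite [X in _ = _ + X]big_nat_cond [X in _ = _ + X]big1 ?addr0; last first.
    by move=> h /andP[/andP[hh _] _]; rewrite /t /c bin_small ?mul0r ?scale0r.
  rewrite exprDn big_mkord mulr_sumr; apply: eq_bigr => h _.
  rewrite /t /c -mul_polyC polyCM polyC_natr -polyCN polyC_exp -mulr_natl.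
  have -> : (n + m - h = n + (m - h))%N by have := ltn_ord h; lia.
  by rewrite exprD; ring.
rewrite main_sumE mulr_sumr (opprD (\sum_(0 <= h < n.+1) t h)) addrA -sumrB.
apply: size_subS; rewrite big_nat_cond;
  apply: (big_ind (fun p : {poly R} => (size p <= m)%N)) => [|p q|h];
  [by rewrite size_poly0 | exact: size_addS | move=> /andP[/andP[h1 h2] _]
  |by rewrite size_poly0 | exact: size_addS | move=> /andP[/andP[h1 h2] _]].
  have -> : ('X - 4) ^+ m * (c h *: map_poly intr (bsum (coefG m) (n - h))) - t h
    = c h *: map_poly intr (('X - 4) ^+ m * bsum (coefG m) (n - h)
        - 'C(2 * m, m)%:R * 'X^(n - h + m)).
    rewrite !(rmorphB, rmorphM, rmorphXn, rmorph_nat) /= map_polyX.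
    rewrite /t (_ : (n + m - h = n - h + m)%N); last by lia.
    by rewrite scalerBr [in RHS]scalerAr.
  rewrite (leq_trans (size_scale_leq _ _)) // (leq_trans (size_poly _ _)) //.
  exact: size_bsum_coefG.
(* For [h > n] the exponent [n + m - h] is below [m]. *)
rewrite /t (leq_trans (size_scale_leq _ _)) // -polyC_natr mul_polyC.
rewrite (leq_trans (size_scale_leq _ _)) // size_polyXn; lia.
Qed.

(** * The formula for the image of [x^(2n) y^(2m)] *)

Theorem theorem5p11 (R : idomainType) (kappa : R) (m n : nat) :
  exists r : {poly R},
    (size (r \Po 'X^2) <= (2 * m).+1)%N /\
    Phi kappa (Vx ^+ (2 * n) * Vy ^+ (2 * m)) =
      \sum_(0 <= i < n.+1) \sum_(0 <= j < i.+1)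
        (('C(2 * m + 2 * j, m + j) * 'C(m + j, m) * 'C(m, i - j))%:R
          * (- kappa) ^+ (i - j)) *: (b R (n - i) \Po 'X^2)
      + (r \Po 'X^2).
Proof.
set S := \sum_(0 <= i < _) _.
have eS : S = main_sum kappa m n \Po 'X^2.
  rewrite /S /main_sum (raddf_sum (comp_poly 'X^2)); apply: eq_bigr => i _.
  rewrite [RHS](raddf_sum (comp_poly 'X^2)); apply: eq_bigr => j _.
  by rewrite /= comp_polyZ.
rewrite -[Vx ^+ _ * _]mulr1 -(expr0 Vz) Phi_monomial {}eS {S}.
have [|| q eq] := @Phi_mon_even R kappa (2 * n) (2 * m) 0; try by lia.
exists (q - main_sum kappa m n); split; last first.
  by rewrite eq comp_polyB addrC subrK.
have hA : 'X^2 - 4 \is @monic R.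
  by rewrite -(polyC_natr _ 4) monicXnsubC.
have [->|nz] := eqVneq ((q - main_sum kappa m n) \Po 'X^2) 0.
  by rewrite size_poly0.
have sA : size (('X^2 - 4 : {poly R}) ^+ m) = (2 * m).+1.
  rewrite (polySpred (expf_neq0 _ (monic_neq0 hA))) size_exp.
  by rewrite -(polyC_natr _ 4) size_XnsubC.
(* The monic factor has degree [2m], so degree at most [4m] for the product gives at most [2m] for
   the remainder. *)
suff: (size (('X^2 - 4) ^+ m * ((q - main_sum kappa m n) \Po 'X^2))%R <= (4 * m).+1)%N.
  rewrite size_monicM ?monic_exp // sA; move: (size (_ \Po _)) => d; lia.
have h1 := size_defect kappa (2 * n) (2 * m) 0.
have h2 := size_main_sum kappa m n.
(* The common term ['C(2m, m) X^(2n) (X^2 - kappa)^m] cancels between the two comparisons. *)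
have -> : ('X^2 - 4) ^+ m * ((q - main_sum kappa m n) \Po 'X^2) =
  defect kappa (2 * n) (2 * m) 0 -
  ((('X - 4) ^+ m * main_sum kappa m n
     - 'C(2 * m, m)%:R * 'X^n * ('X - kappa%:P) ^+ m) \Po 'X^2).
  rewrite /defect eq ctR0 addn0 cbin_even.
  have -> : ((2 * m)./2 = m) by lia.
  rewrite !comp_polyB !comp_polyM !rmorphXn /= !comp_polyB -!(polyC_natr _ 4).
  rewrite !comp_polyC !comp_polyX -polyC_natr !comp_polyC exprM.
  by ring.
apply: size_subS; first by apply: leq_trans h1 _; lia.
rewrite (leq_trans (size_comp_poly_leq _ _)) // size_polyXn /=.
move: (size _) h2 => d; lia.
Qed.
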